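(* Let $f\in\mathbb{Z}[x_1,\dots,x_n]$ be nonconstant with $f(0)=0$, and let $\tau$ be a face of $\Delta_0(f)$. Then for all $k\in\mathbb{N}^n$ with $F(f)(k)=\tau$, $$\nu(k)\ge\sigma(f)\big(N(f)(k)+1\big)-\sigma(f_\tau).$$
   Context: Write $f=\sum_{i\in\mathbb{N}^n}a_ix^i$; ${\rm Supp}(f)=\{i\in\mathbb{N}^n:a_i\ne0\}$; $\Delta_0(f)=\mathrm{conv}({\rm Supp}(f))+\mathbb{R}_+^n$ with $\mathbb{R}_+=[0,\infty)$. For $I\subset\mathbb{R}^n$, $f_I:=\sum_{i\in I\cap\mathbb{N}^n}a_ix^i$. The faces of a set $I\subset\mathbb{R}^n$ are $I$ itself and every nonempty set $\{x\in I:L(x)=0\}$ with $L$ a real affine function, $L\ge0$ on $I$. For a polynomial $g$ (such as $f$ or $f_\tau$), $(1/\sigma(g),\dots,1/\sigma(g))$ is the point where the diagonal $\{(t,\dots,t):t\in\mathbb{R}\}$ meets the smallest face of $\Delta_0(g)$ intersecting the diagonal (i.e. the boundary point of $\Delta_0(g)$ on the diagonal). For $k\in\mathbb{R}_+^n$: $\nu(k)=k_1+\dots+k_n$, $N(f)(k)=\min_{i\in\Delta_0(f)}k\cdot i$, $F(f)(k)=\{i\in\Delta_0(f):k\cdot i=N(f)(k)\}$. *)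

(* Defs.v *)
From mathcomp Require Import all_boot all_order all_algebra.
From mathcomp Require Import mpoly.
From mathcomp Require Import boolp classical_sets reals.

Set Implicit Arguments.
Unset Strict Implicit.
Unset Printing Implicit Defensive.

Import Order.TTheory GRing.Theory Num.Theory.

Local Open Scope classical_set_scope.
Local Open Scope ring_scope.

Section Newton.
Variables (R : realType) (n : nat).

Implicit Types (A I : set 'rV[R]_n) (f g : {mpoly int[n]}) (k x : 'rV[R]_n).

Definition natvec (m : 'I_n -> nat) : 'rV[R]_n := \row_j (m j)%:R.

Definition dot k x : R := \sum_(j < n) k 0 j * x 0 j.

Definition conv A : set 'rV[R]_n :=
  [set x | exists (r : nat) (p : 'I_r -> 'rV[R]_n) (w : 'I_r -> R),
     [/\ forall l, A (p l), forall l, 0 <= w l, \sum_l w l = 1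
       & x = \sum_l w l *: p l]].

Definition orthant : set 'rV[R]_n := [set x | forall j, 0 <= x 0 j].

Definition Supp f : set 'rV[R]_n :=
  [set x | exists2 m : 'X_{1..n}, f@_m != 0 & x = natvec m].

Definition Delta0 f : set 'rV[R]_n :=
  [set x + y | x in conv (Supp f) & y in orthant].

Definition restr f I : {mpoly int[n]} :=
  \sum_(m <- msupp f | `[< I (natvec m) >]) f@_m *: 'X_[m].

(* The affine function [L] is written [fun x => dot a x + b]. *)
Definition face I A : Prop :=
  A = I \/
  exists (a : 'rV[R]_n) (b : R),
    [/\ forall x, I x -> 0 <= dot a x + b,
        A = [set x | I x /\ dot a x + b = 0]
      & A !=set0].

Definition diagonal : set 'rV[R]_n := [set x | exists t : R, x = const_mx t].

Definition smallest_diag_face I A : Prop :=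
  [/\ face I A, A `&` diagonal !=set0
    & forall B, face I B -> B `&` diagonal !=set0 -> A `<=` B].

Definition is_sigma g (s : R) : Prop :=
  s != 0 /\
  exists2 A, smallest_diag_face (Delta0 g) A
           & A `&` diagonal = [set const_mx s^-1].

(* The default value 0 is only taken when no [s] qualifies, for example when
   [g = 0], or when [0 < n] and [Delta0 g] contains the origin. *)
Definition sigma g : R := xget 0 (is_sigma g).

Definition nu k : R := \sum_(j < n) k 0 j.

Definition minimum (S : set R) : R := xget 0 (S `&` lbound S).

Definition N f k : R := minimum [set dot k i | i in Delta0 f].

Definition F f k : set 'rV[R]_n := [set i | Delta0 f i /\ dot k i = N f k].

End Newton.

Arguments natvec R {n} m.
Arguments Supp R {n} f.
Arguments Delta0 R {n} f.
Arguments sigma R {n} g.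

(* Main.v *)
Require Import Defs.
From mathcomp Require Import all_boot all_order all_algebra.
From mathcomp Require Import mpoly.
From mathcomp Require Import boolp classical_sets reals.
From mathcomp Require Import ring lra.

Import Order.TTheory GRing.Theory Num.Theory.

Local Open Scope ring_scope.

(** Write the diagonal point [1/sigma(f)] of [Delta0 f] as a convex combination
    of exponents of [f] plus a vector of the orthant, and let [W] be the total
    weight of the exponents lying on [tau].  An exponent off [tau] pairs with [k]
    to at least [N(f)(k) + 1] because everything is integral, so pairing the
    combination with [k] gives [nu(k) / sigma(f) >= N(f)(k) + 1 - W].  Keeping
    only the exponents on [tau] and dividing by [W] shows that the diagonal point
    [1/(W sigma(f))] lies in [Delta0 f_tau], so [W sigma(f) <= sigma(f_tau)].

    For the last inequality [sigma(f_tau)] must not be the default value 0, so the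
    smallest face meeting the diagonal has to exist.  By Fourier-Motzkin
    elimination [Delta0 g] is a finite intersection of half-spaces; the face is
    cut out by the constraints that are tight at the lowest diagonal point. *)

(** * Bilinearity and positivity of the pairing [dot] *)

Section Dot.
Variables (R : realType) (n : nat).
Implicit Types (x y k : 'rV[R]_n).

Lemma dotDr k x y : dot k (x + y) = dot k x + dot k y.
Proof. by rewrite -big_split; apply: eq_bigr => j _; rewrite mxE mulrDr. Qed.

Lemma dotZr k (a : R) x : dot k (a *: x) = a * dot k x.
Proof. by rewrite /dot mulr_sumr; apply: eq_bigr => j _; rewrite mxE mulrCA. Qed.

Lemma dotC k x : dot k x = dot x k.
Proof. by apply: eq_bigr => j _; rewrite mulrC. Qed.

Lemma dotDl k x y : dot (x + y) k = dot x k + dot y k.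
Proof. by rewrite dotC dotDr !(dotC k). Qed.

Lemma dotZl k (a : R) x : dot (a *: x) k = a * dot x k.
Proof. by rewrite dotC dotZr dotC. Qed.

Lemma dotBr k x y : dot k (x - y) = dot k x - dot k y.
Proof. by rewrite -scaleN1r dotDr dotZr mulN1r. Qed.

Lemma dot0l x : dot 0 x = 0.
Proof. by rewrite -(scale0r 0) dotZl mul0r. Qed.

Lemma dot_suml (I : Type) (s : seq I) (P : pred I) (a : I -> 'rV[R]_n) x :
  dot (\sum_(i <- s | P i) a i) x = \sum_(i <- s | P i) dot (a i) x.
Proof.
by apply: (big_morph (fun a => dot a x)) => [a1 a2|]; rewrite ?dotDl ?dot0l.
Qed.

Lemma dot_sumr (I : Type) (s : seq I) (P : pred I) k (a : I -> 'rV[R]_n) :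
  dot k (\sum_(i <- s | P i) a i) = \sum_(i <- s | P i) dot k (a i).
Proof. by rewrite dotC dot_suml; apply: eq_bigr => i _; rewrite dotC. Qed.

Lemma dot_delta j x : dot (delta_mx 0 j) x = x 0 j.
Proof.
rewrite /dot (bigD1 j) //= big1 ?addr0 => [|i ij]; first by rewrite mxE !eqxx mul1r.
by rewrite mxE (negbTE ij) andbF mul0r.
Qed.

Lemma dot_const k (t : R) : dot k (const_mx t) = t * nu k.
Proof. by rewrite /dot /nu mulr_sumr; apply: eq_bigr => j _; rewrite mxE mulrC. Qed.

Lemma dot_ge0 k x : orthant k -> orthant x -> 0 <= dot k x.
Proof. by move=> k0 x0; apply: sumr_ge0 => j _; apply: mulr_ge0. Qed.

Lemma orthant_natvec (m : 'I_n -> nat) : orthant (natvec R m).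
Proof. by move=> j; rewrite mxE. Qed.

Lemma dot_natvec (k m : 'I_n -> nat) :
  dot (natvec R k) (natvec R m) = (\sum_(j < n) k j * m j)%N%:R.
Proof. by rewrite natr_sum; apply: eq_bigr => j _; rewrite !mxE natrM. Qed.

End Dot.

(** * Finite maxima, uniform bounds and elimination of one variable *)

Lemma exists_seq_max (R : realDomainType) (T : eqType) (F : T -> R) (s : seq T) x0 :
  x0 \in s -> exists2 x, x \in s & forall y, y \in s -> F y <= F x.
Proof.
elim: s x0 => // a s IH x0 _; case: s IH => [|b s] IH.
  by exists a; rewrite ?mem_head // => y; rewrite inE => /eqP ->.
have [x xs xmax] := IH b (mem_head _ _); have [ax|xa] := leP (F a) (F x).
  by exists x => [|y]; rewrite in_cons ?xs ?orbT // => /orP [/eqP ->|/xmax].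
exists a => [|y]; rewrite in_cons ?eqxx // => /orP [/eqP -> //|/xmax yx].
exact: le_trans yx (ltW xa).
Qed.

(** Supplies a step size small enough to preserve finitely many strict inequalities at once. *)
Lemma exists_pos_bound (R : realFieldType) (T : eqType) (a d : T -> R) (s : seq T) :
  (forall x, x \in s -> 0 < a x) ->
  exists2 e, 0 < e & forall x, x \in s -> e * `|d x| <= a x.
Proof.
elim: s => [|b s IH] ha; first by exists 1.
have [x xs|e e0 he] := IH; first by apply: ha; rewrite inE xs orbT.
have ab : 0 < a b by apply: ha; exact: mem_head.
have db : 0 < 1 + `|d b| by rewrite ltr_pwDl.
(* Adding 1 to the denominator avoids division by zero when [d b] vanishes. *)
exists (Num.min e (a b / (1 + `|d b|))); first by rewrite lt_min e0 divr_gt0.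
move=> x /[1!inE] /orP [/eqP ->|xs].
  apply: (@le_trans _ _ (a b / (1 + `|d b|) * `|d b|)).
    by rewrite ler_wpM2r // ge_min lexx orbT.
  by rewrite mulrAC ler_pdivrMr // ler_pM2l // lerDr.
by apply: le_trans (he x xs); rewrite ler_wpM2r // ge_min lexx.
Qed.

(* One step of Fourier-Motzkin elimination: [u] ranges over the nonnegative
   solutions of [u * p.2 <= p.1]. *)
Lemma fourier_motzkin (R : realFieldType) (s : seq (R * R)) :
  (exists2 u, 0 <= u & forall p, p \in s -> u * p.2 <= p.1) <->
  (forall p, p \in s -> 0 <= p.2 -> 0 <= p.1) /\
  (forall p q, p \in s -> q \in s -> p.2 < 0 -> 0 < q.2 ->
     0 <= q.2 * p.1 - p.2 * q.1).
Proof.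
split=> [[u u0 hu]|[h1 h2]].
  split=> [p ps p2|p q ps qs p2 q2].
    by apply: le_trans (hu p ps); rewrite mulr_ge0.
  by have := hu p ps; have := hu q qs; nra.
(* The witness is the largest lower bound on [u]: either 0 or a quotient coming from a negative
   [p.2]. *)
pose l := 0 :: [seq p.1 / p.2 | p <- s & p.2 < 0].
have [u ul umax] := @exists_seq_max R R id l 0 (mem_head _ _).
exists u; first by apply: umax; exact: mem_head.
move=> p ps; have [p2|p2|p2] := ltgtP p.2 0.
- rewrite -ler_ndivrMr //; apply: umax; rewrite inE; apply/orP; right.
  by apply/mapP; exists p; rewrite // mem_filter p2.
- move: ul; rewrite inE => /orP [/eqP ->|/mapP [q]].
    by rewrite mul0r h1 ?ltW.
  rewrite mem_filter => /andP [q2 qs] ->.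
  rewrite mulrAC ler_ndivrMr //; have := h2 q p qs ps q2 p2; lra.
- by rewrite p2 mulr0 h1 ?p2.
Qed.

(** * Half-space description of finitely generated polyhedra *)

Section Polyhedron.
Variables (R : realType) (n : nat).
Implicit Types (x y : 'rV[R]_n) (s : seq 'rV[R]_n) (c : 'rV[R]_n * R).

(* Weights are indexed by positions in [s]; the variable [t] homogenizes
   [conv s + orthant], which is recovered at [t = 1]. *)
Definition cone s x (t : R) : Prop :=
  exists w : nat -> R, [/\ forall i, 0 <= w i, t = \sum_(i < size s) w i
    & forall j, \sum_(i < size s) w i * s`_i 0 j <= x 0 j].

Definition affine c x (t : R) : R := dot c.1 x + c.2 * t.

Lemma cone_nil x t : cone [::] x t <-> orthant x /\ t = 0.
Proof.
split=> [[w [_ -> wx]]|[x0 ->]].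
  by split=> [j|]; [have := wx j; rewrite big_ord0|rewrite big_ord0].
by exists (fun=> 0); split=> [//||j]; rewrite big_ord0.
Qed.

Lemma cone_cons v s x t :
  cone (v :: s) x t <-> exists2 u, 0 <= u & cone s (x - u *: v) (t - u).
Proof.
split=> [[w [w0 -> wx]]|[u u0 [w [w0 wt wx]]]].
  exists (w 0%N) => //; exists (fun i => w i.+1); split=> // [|j].
    by rewrite big_ord_recl addrC addKr.
  by have := wx j; rewrite big_ord_recl !mxE /=; lra.
exists (fun i => if i is i'.+1 then w i' else u); split=> [[]//||j] /=.
  by rewrite big_ord_recl /= -wt; lra.
by have := wx j; rewrite big_ord_recl !mxE /=; lra.
Qed.

(** Induction on the generators: [cone_cons] isolates the weight [u] of the first one, and
    Fourier-Motzkin removes it from the constraints found for the others. *)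
Lemma cone_halfspaces s : exists cs : seq ('rV[R]_n * R), forall x t,
  cone s x t <-> forall c, c \in cs -> 0 <= affine c x t.
Proof.
elim: s => [|v s [cs hcs]].
  (* The first two constraints force [t = 0], the others the sign of each coordinate. *)
  pose cs := (0, 1) :: (0, -1) :: [seq (delta_mx 0 j, 0) | j <- enum 'I_n]
    : seq ('rV[R]_n * R).
  exists cs => x t; rewrite cone_nil; split=> [[x0 ->] c|h].
    rewrite !inE => /or3P [/eqP->|/eqP->|/mapP [j _ ->]];
      by rewrite /affine /= ?dot0l ?dot_delta ?mulr0 ?addr0.
  split=> [j|].
    have : (delta_mx 0 j, 0) \in cs by rewrite !inE map_f ?orbT ?mem_enum.
    by move=> /h; rewrite /affine /= dot_delta mul0r addr0.
  have := h (0, 1); have := h (0, -1); rewrite /affine /= dot0l !inE !eqxx ?orbT.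
  by move=> /(_ isT) ? /(_ isT) ?; lra.
(* Subtracting [u] copies of [v] lowers the constraint [c] by [u * b c]; in [comb c d] these
   contributions cancel. *)
pose b c := affine c v 1.
pose comb c d : 'rV[R]_n * R := (b d *: c.1 - b c *: d.1, b d * c.2 - b c * d.2).
have combE c d x t : affine (comb c d) x t = b d * affine c x t - b c * affine d x t.
  rewrite {1}/affine /= -scaleNr dotDl !dotZl /affine; ring.
exists ([seq c <- cs | 0 <= b c] ++
        [seq comb c d | c <- [seq c <- cs | b c < 0], d <- [seq d <- cs | 0 < b d]]).
move=> x t; rewrite cone_cons.
have subE c u : affine c (x - u *: v) (t - u) = affine c x t - u * b c.
  rewrite /affine dotBr dotZr /b /affine; ring.
have -> : (exists2 u, 0 <= u & cone s (x - u *: v) (t - u)) <->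
    exists2 u, 0 <= u & forall p, p \in [seq (affine c x t, b c) | c <- cs] ->
      u * p.2 <= p.1.
  split=> -[u u0 h]; exists u => //.
    move=> p /mapP [c cs_c ->] /=; have := (hcs _ _).1 h c cs_c.
    by rewrite subE; lra.
  apply/hcs => c cs_c; have := h (affine c x t, b c); rewrite subE /= map_f //.
  by move=> /(_ isT); lra.
rewrite fourier_motzkin; split=> [[h1 h2] c|h].
  rewrite mem_cat => /orP [|/allpairsP [[d e] /= []]].
    rewrite mem_filter => /andP [bc cs_c].
    by apply: (h1 (affine c x t, b c)); rewrite ?map_f.
  rewrite !mem_filter => /andP [bd ds] /andP [be es] ->; rewrite combE.
  by apply: (h2 (affine d x t, b d) (affine e x t, b e)); rewrite ?map_f.
split=> [p /mapP [c cs_c ->] /= bc|p q /mapP [c cs_c ->] /mapP [d cs_d ->] /= bc bd].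
  by apply: h; rewrite mem_cat mem_filter bc cs_c.
rewrite -combE; apply: h; rewrite mem_cat; apply/orP; right.
by apply/allpairsP; exists (c, d); rewrite /= !mem_filter bc bd.
Qed.

End Polyhedron.

(** * Newton polyhedra, their faces and the diagonal *)

Section Newton.
Variables (R : realType) (n : nat).
Implicit Types (x y k : 'rV[R]_n) (f g : {mpoly int[n]}).

Lemma mpoly_neq0_mcoeff g : g != 0 -> exists m, g@_m != 0.
Proof.
rewrite -msupp_eq0; case E: (msupp g) => [//|m s] _; exists m.
by rewrite -mcoeff_msupp E mem_head.
Qed.

Lemma Delta0P g x : Delta0 R g x <->
  exists (r : nat) (m : 'I_r -> 'X_{1..n}) (w : 'I_r -> R),
    [/\ forall l, g@_(m l) != 0, forall l, 0 <= w l, \sum_l w l = 1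
      & orthant (x - \sum_l w l *: natvec R (m l))].
Proof.
split=> [[a [r [p [w [hp w0 w1 ->]]]] [y y0 <-]]|[r [m [w [hm w0 w1 hx]]]]].
  have /choice [m hm] : forall l, exists m : 'X_{1..n}, g@_m != 0 /\ p l = natvec R m.
    by move=> l; have [m] := hp l; exists m.
  exists r, m, w; split=> // [l|]; first by have [] := hm l.
  rewrite (eq_bigr (fun l => w l *: natvec R (m l))) => [|l _]; last by have [_ ->] := hm l.
  by rewrite addrAC subrr add0r.
exists (\sum_l w l *: natvec R (m l)).
  by exists r, (fun l => natvec R (m l)), w; split=> // l; exists (m l).
by exists (x - \sum_l w l *: natvec R (m l)); rewrite // addrC subrK.
Qed.

Lemma Delta0_cone g x :
  Delta0 R g x <-> cone R n [seq natvec R (m : 'X_{1..n}) | m <- msupp g] x 1.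
Proof.
set s := map _ _; have s_natvec (m : 'X_{1..n}) : m \in msupp g -> natvec R m \in s.
  by move=> ms; apply/mapP; exists m.
rewrite Delta0P; split=> [[r [m [w [hm w0 w1 hx]]]]|[w [w0 w1 hx]]].
  have ms l : (index (natvec R (m l)) s < size s)%N.
    by rewrite index_mem s_natvec // mcoeff_msupp.
  pose o l := Ordinal (ms l).
  (* A convex combination may repeat an exponent, so the weights sharing a position in [s] are added
     up. *)
  exists (fun i => \sum_(l | val (o l) == i) w l); split=> [i||j].
  - exact: sumr_ge0.
  - by rewrite -w1 (partition_big o predT).
  have := hx j; rewrite !mxE subr_ge0 summxE; apply: le_trans.
  rewrite (partition_big o predT) //=; apply: ler_sum => i _.
  rewrite mulr_suml; apply: ler_sum => l /eqP <-.
  by rewrite [leRHS]mxE nth_index ?s_natvec ?mcoeff_msupp.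
have sz : size s = size (msupp g) by rewrite size_map.
exists (size s), (fun l => nth 0%MM (msupp g) l), w; split=> // [l|j].
  by rewrite -mcoeff_msupp mem_nth // -sz.
rewrite !mxE subr_ge0 summxE; apply: le_trans (hx j); apply: ler_sum => l _.
by rewrite (nth_map 0%MM) ?mxE // -sz.
Qed.

Lemma Delta0_natvec g (m : 'X_{1..n}) : g@_m != 0 -> Delta0 R g (natvec R m).
Proof.
move=> gm; apply/Delta0P; exists 1%N, (fun=> m), (fun=> 1).
by split=> // [|j]; rewrite big_ord1 // scale1r subrr mxE.
Qed.

Lemma Delta0D g x y : Delta0 R g x -> orthant y -> Delta0 R g (x + y).
Proof.
move=> [a ha [z z0 <-]] y0; exists a => //; exists (z + y); last by rewrite addrA.
by move=> j; rewrite mxE addr_ge0.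
Qed.

Lemma Delta0_orthant g x : Delta0 R g x -> orthant x.
Proof.
move=> /Delta0P [r [m [w [_ w0 _ hx]]]] j; have := hx j.
rewrite !mxE subr_ge0; apply: le_trans; rewrite summxE; apply: sumr_ge0 => l _.
by rewrite !mxE mulr_ge0.
Qed.

Lemma Delta0_lower_bound g k (b : R) x : orthant k ->
  (forall m : 'X_{1..n}, g@_m != 0 -> b <= dot k (natvec R m)) ->
  Delta0 R g x -> b <= dot k x.
Proof.
move=> k0 hb /Delta0P [r [m [w [hm w0 w1 hx]]]].
have := dot_ge0 _ _ _ _ k0 hx; rewrite dotBr subr_ge0; apply: le_trans.
rewrite dot_sumr -(mul1r b) -w1 mulr_suml; apply: ler_sum => l _.
by rewrite dotZr ler_wpM2l // hb.
Qed.

(** [Delta0 g] is stable under moving up along any axis, and a negative slope would make the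
    function negative far along that axis. *)
Lemma face_slope_ge0 g (a : 'rV[R]_n) (b : R) : g != 0 ->
  (forall x, Delta0 R g x -> 0 <= dot a x + b) -> orthant a.
Proof.
move=> /mpoly_neq0_mcoeff [m gm] h j.
rewrite leNgt; apply/negP => aj.
have hx := Delta0_natvec _ _ gm; have A0 := h _ hx.
(* This [t] brings the value of the function down to exactly -1. *)
set A := dot _ _ + b in A0; pose t := (A + 1) / - a 0 j.
have t0 : 0 <= t by rewrite divr_ge0 //; lra.
have := h (natvec R m + t *: delta_mx 0 j).
have -> : dot a (natvec R m + t *: delta_mx 0 j) + b = -1.
  rewrite dotDr dotZr (dotC _ _ _ (delta_mx _ _)) dot_delta.
  have : t * a 0 j = - (A + 1) by rewrite /t; field; lra.
  by move=> ->; rewrite /A; lra.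
have /[swap] /[apply] : Delta0 R g (natvec R m + t *: delta_mx 0 j).
  apply: Delta0D => // i; rewrite !mxE mulr_ge0 //.
lra.
Qed.

(* A supporting affine function of [Delta0 g] has nonnegative slopes, so on the
   diagonal it can only vanish at the lowest point. *)
Lemma face_diag_le g A (s t : R) : g != 0 -> face (Delta0 R g) A -> s <= t ->
  Delta0 R g (const_mx s) -> A (const_mx t) -> A (const_mx s).
Proof.
move=> g0 [-> //|[a [b [h -> _]]]] st hs [ht e]; split=> //.
have a0 := face_slope_ge0 _ _ _ g0 h; have := h _ hs; move: e.
have : 0 <= nu a by apply: sumr_ge0 => j _.
rewrite !dot_const; nra.
Qed.

Lemma is_sigma_gt0 g (s : R) : (0 < n)%N -> is_sigma g s ->
  0 < s /\ Delta0 R g (const_mx s^-1).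
Proof.
move=> n0 [s0 [A [fA _ _] Ad]].
have [As _] : (A `&` @Defs.diagonal R n)%classic (const_mx s^-1) by rewrite Ad.
have D : Delta0 R g (const_mx s^-1) by case: fA As => [->|[a [b [_ -> _]]] []].
split=> //; have := Delta0_orthant _ _ D (Ordinal n0).
by rewrite mxE invr_ge0 le_eqVlt eq_sym (negbTE s0).
Qed.

Lemma sigma_ge0 g : (0 < n)%N -> 0 <= sigma R g.
Proof.
by move=> n0; rewrite /sigma; case: xgetP => [s _ /is_sigma_gt0 [] // /ltW|].
Qed.

(** By [face_diag_le], a lower diagonal point would lie on the same face, which meets the diagonal
    only once. *)
Lemma is_sigma_min g (s t : R) : g != 0 -> is_sigma g s ->
  Delta0 R g (const_mx t) -> (0 < n)%N -> s^-1 <= t.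
Proof.
move=> g0 [s0 [A [fA _ _] Ad]] D n0; rewrite leNgt; apply/negP => ts.
have [As _] : (A `&` @Defs.diagonal R n)%classic (const_mx s^-1) by rewrite Ad.
have At := face_diag_le _ _ _ _ g0 fA (ltW ts) D As.
have : (A `&` @Defs.diagonal R n)%classic (const_mx t) by split=> //; exists t.
rewrite Ad => /rowP /(_ (Ordinal n0)); rewrite !mxE => e.
by rewrite e ltxx in ts.
Qed.

Lemma nu_natvec_ge1 (m : 'X_{1..n}) : m != 0%MM -> 1 <= nu (natvec R m).
Proof.
move=> m0; have -> : nu (natvec R m) = (mdeg m)%:R.
  by rewrite mdegE natr_sum; apply: eq_bigr => j _; rewrite mxE.
by rewrite ler1n lt0n mdeg_eq0.
Qed.

Lemma is_sigma_exists g : g != 0 -> g@_0%MM = 0 -> exists s : R, is_sigma g s.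
Proof.
move=> gn0 g0.
have [m0 gm0] := mpoly_neq0_mcoeff _ gn0.
have supp_n0 m : g@_m != 0 -> m != 0%MM by apply: contraNneq => ->; rewrite g0.
have n0 : (0 < n)%N.
  rewrite lt0n; apply: contraNneq (supp_n0 _ gm0) => n0.
  by apply/eqP/mnmP => -[j jn]; exfalso; move: jn; rewrite n0.
have [cs hcs] := cone_halfspaces R n [seq natvec R (m : 'X_{1..n}) | m <- msupp g].
have {hcs} D x : Delta0 R g x <-> forall c, c \in cs -> 0 <= dot c.1 x + c.2.
  by rewrite Delta0_cone hcs /affine; split=> h c /h; rewrite mulr1.
have nu0 c : c \in cs -> 0 <= nu c.1.
  move=> cc; apply: sumr_ge0 => j _; apply: (face_slope_ge0 g c.1 c.2) => //.
  by move=> x /D /(_ c cc).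
(* Without a constant term every exponent has coordinate sum at least 1, and this bound passes to
   all of [Delta0 g]. *)
have diag_pos t : Delta0 R g (const_mx t) -> 0 < t.
  have one0 : orthant (const_mx 1 : 'rV[R]_n) by move=> j; rewrite mxE.
  have one m : g@_m != 0 -> 1 <= dot (const_mx 1) (natvec R m).
    by move=> /supp_n0 /nu_natvec_ge1; rewrite dotC dot_const mul1r.
  move=> h; have := Delta0_lower_bound _ _ _ _ one0 one h.
  rewrite dot_const; have : 0 <= nu (const_mx 1 : 'rV[R]_n).
    by apply: sumr_ge0 => j _; rewrite mxE.
  nra.
have [t1 Dt1] : exists t, Delta0 R g (const_mx t).
  exists (\sum_j (natvec R m0) 0 j); rewrite -[const_mx _](addrNK (natvec R m0)).
  rewrite addrC; apply: Delta0D; first exact: Delta0_natvec.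
  move=> j; rewrite !mxE (bigD1 j) //= mxE addrC addKr.
  by apply: sumr_ge0 => i _; rewrite mxE.
have flat c : c \in cs -> nu c.1 = 0 -> 0 <= c.2.
  by move=> cc e; have := (D _).1 Dt1 c cc; rewrite dot_const e mulr0 add0r.
(* If no constraint had positive slope along the diagonal, the origin would satisfy them all. *)
have [c1 c1P] : exists c, c \in [seq c <- cs | 0 < nu c.1].
  have [[c /andP [cc cn]]|no] := pselect (exists c, (c \in cs) && (0 < nu c.1)).
    by exists c; rewrite mem_filter cn.
  have : Delta0 R g (const_mx 0); last by move/diag_pos; rewrite ltxx.
  apply/D => c cc; rewrite dot_const mul0r add0r; apply: flat => //; apply/eqP.
  rewrite eq_le nu0 // leNgt andbT; apply/negP => cn; apply: no; exists c.
  by rewrite cc.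
(* On the diagonal a constraint of positive slope reads [t >= - c.2 / nu c.1], so the largest such
   bound [t0] is the lowest diagonal point. *)
have [c0] := exists_seq_max _ _ (fun c => - c.2 / nu c.1) _ _ c1P.
rewrite mem_filter => /andP [c0n c0s] c0max; set t0 := - c0.2 / _ in c0max.
pose q : 'rV[R]_n := const_mx t0.
have Dq : Delta0 R g q.
  apply/D => c cc; rewrite dot_const; have := nu0 c cc; rewrite le_eqVlt.
  move=> /orP [/eqP e|cn]; first by rewrite -e mulr0 add0r flat.
  have : - c.2 / nu c.1 <= t0 by apply: c0max; rewrite mem_filter cn.
  rewrite ler_pdivrMr //; lra.
have t0_gt0 := diag_pos _ Dq.
pose tight (c : 'rV[R]_n * R) := dot c.1 q + c.2 == 0.
have tight0 : tight c0.
  by apply/eqP; rewrite dot_const /t0; field; rewrite gt_eqF.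
(* A sum of nonnegative terms vanishes only if each does, so one affine function imposes all tight
   constraints. *)
pose a := \sum_(c <- cs | tight c) c.1; pose b := \sum_(c <- cs | tight c) c.2.
have abE x : dot a x + b = \sum_(c <- cs | tight c) (dot c.1 x + c.2).
  by rewrite big_split dot_suml.
pose A : set 'rV[R]_n := [set x | Delta0 R g x /\ dot a x + b = 0]%classic.
have Aq : A q by split=> //; rewrite abE big1 // => c /eqP.
have A_tight x c : A x -> c \in cs -> tight c -> dot c.1 x + c.2 = 0.
  move=> [/D Dx]; rewrite abE => e cc tc; apply/eqP; move: e.
  rewrite big_seq_cond => /eqP; rewrite psumr_eq0 => [|d /andP [ds _]]; last exact: Dx.
  by move=> /allP /(_ c cc); rewrite cc tc.
have A_face : face (Delta0 R g) A.
  right; exists a, b; split=> //; last by exists q.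
  move=> x /D Dx; rewrite abE big_seq_cond; apply: sumr_ge0 => c /andP [cc _].
  exact: Dx.
exists t0^-1; split; first by rewrite invr_eq0 gt_eqF.
exists A; last first.
  rewrite invrK; apply/seteqP; split=> [x [Ax [t xt]]|x -> /=]; last first.
    by split=> //; exists t0.
  (* [c0] is tight and has positive slope along the diagonal, which pins [t] to [t0]. *)
  rewrite xt /=; congr const_mx; have := A_tight _ _ Ax c0s tight0.
  rewrite xt dot_const /t0 => e; apply: (mulIf (lt0r_neq0 c0n)).
  rewrite divfK ?gt_eqF //; lra.
split=> //; first by exists q; split=> //; exists t0.
move=> B fB [z [Bz [t zt]]]; have Bq : B q.
  have Dt : Delta0 R g (const_mx t).
    by rewrite -zt; case: fB Bz => [->|[? [? [_ -> _]]] []].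
  apply: (face_diag_le g B t0 t) => //; last by rewrite -zt.
  have := (D _).1 Dt c0 c0s; rewrite dot_const /t0 ler_pdivrMr //; lra.
case: fB Bq => [-> _ x []//|[a' [b' [L0 -> _]]] [_ Lq] x Ax]; split; first by case: Ax.
(* The segment from [x] to [q] can be prolonged inside [Delta0 g] beyond [q],
   so the supporting function [dot a' _ + b'], which is zero at [q], cannot be
   positive at [x]. *)
have [c|e e0 he] := exists_pos_bound _ _ (fun c => dot c.1 q + c.2)
    (fun c => dot c.1 x + c.2) [seq c <- cs | ~~ tight c].
  rewrite mem_filter /tight => /andP [tc cc].
  by rewrite lt_neqAle eq_sym tc (D q).1.
have affE (u : 'rV[R]_n) v : dot u (q + e *: (q - x)) + v =
    (1 + e) * (dot u q + v) - e * (dot u x + v).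
  by rewrite dotDr dotZr dotBr; ring.
have : Delta0 R g (q + e *: (q - x)).
  apply/D => c cc; rewrite affE; have [tc|tc] := boolP (tight c).
    by rewrite (A_tight x) // (eqP tc) !mulr0 subr0.
  have := he c; rewrite mem_filter tc cc => /(_ isT) hc.
  have := (D q).1 Dq c cc; have := ler_norm (dot c.1 x + c.2).
  nra.
move=> /L0; rewrite affE Lq mulr0 add0r oppr_ge0 pmulr_rle0 // => L.
by apply/eqP; rewrite eq_le L L0 //; case: Ax.
Qed.

(** * Coefficients of restrictions, and the minimum [N] *)

Lemma mcoeff_restr f (I : set 'rV[R]_n) (m : 'X_{1..n}) :
  (restr f I)@_m = if `[< I (natvec R m) >] then f@_m else 0.
Proof.
rewrite /restr raddf_sum /=.
under eq_bigr => i _ do rewrite mcoeffZ mcoeffX.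
have [ms|ms] := boolP (m \in msupp f).
  rewrite big_mkcond (bigD1_seq m) //= big1 ?addr0 => [|i im].
    by rewrite eqxx mulr1.
  by rewrite (negbTE im) mulr0 if_same.
rewrite big1_seq => [|i /andP [_ is_]].
  by rewrite (memN_msupp_eq0 ms) if_same.
by case: eqP ms is_ => [-> /negP //|]; rewrite mulr0.
Qed.

Lemma mcoeff0_eval f : f.@[fun=> 0] = f@_0%MM.
Proof.
rewrite mevalE.
have P (m : 'X_{1..n}) : \prod_(i < n) (0 : int) ^+ m i = (m == 0%MM)%:R :> int.
  have [->|m0] := eqVneq m 0%MM; first by rewrite big1 // => i _; rewrite mnm0E.
  have [i mi] : exists i, m i != 0%N.
    apply/existsP; move: m0; apply: contraR; rewrite negb_exists => /forallP h.
    by apply/eqP/mnmP => i; rewrite mnm0E; apply/eqP; have := h i; rewrite negbK.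
  by rewrite (bigD1 i) //= expr0n (negbTE mi) mul0r.
under eq_bigr => m _ do rewrite P.
have [ms|ms] := boolP (0%MM \in msupp f).
  rewrite (bigD1_seq 0%MM) //= eqxx mulr1 big1 ?addr0 // => m /negbTE ->.
  by rewrite mulr0.
rewrite big1_seq ?(memN_msupp_eq0 ms) // => m /andP [_ mf].
by case: eqP ms mf => [-> /negP //|]; rewrite mulr0.
Qed.

(** The support is finite and [k] is nonnegative, so some exponent minimizes the pairing; hence
    [N f k] is a true minimum and not the default value of [minimum]. *)
Lemma N_attained f k : f != 0 -> orthant k ->
  (exists2 m : 'X_{1..n}, f@_m != 0 & N f k = dot k (natvec R m)) /\
  (forall x, Delta0 R f x -> N f k <= dot k x).
Proof.
move=> f0 k0.
have [m1] := mpoly_neq0_mcoeff _ f0; rewrite -mcoeff_msupp => m1s.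
have [m ms mmax] := exists_seq_max _ _ (fun m : 'X_{1..n} => - dot k (natvec R m)) _ _ m1s.
have fm : f@_m != 0 by rewrite -mcoeff_msupp.
have lb x : Delta0 R f x -> dot k (natvec R m) <= dot k x.
  apply: Delta0_lower_bound => // m'; rewrite -mcoeff_msupp => /mmax.
  by rewrite lerN2.
have -> : N f k = dot k (natvec R m).
  apply: xget_unique => [|y [[x Dx <-] yl]].
    split; first by exists (natvec R m) => //; exact: Delta0_natvec.
    by move=> _ [x Dx <-]; exact: lb.
  apply/eqP; rewrite eq_le lb // andbT; apply: yl.
  by exists (natvec R m) => //; exact: Delta0_natvec.
by split=> //; exists m.
Qed.

End Newton.

Theorem theorem4p1 (R : realType) (n : nat) (f : {mpoly int[n]})
    (f_nonconstant : forall c : int, f <> c%:MP_[n])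
    (f0 : f.@[fun=> 0] = 0)
    (tau : set 'rV[R]_n) (tau_face : face (Delta0 R f) tau) :
  forall k : 'I_n -> nat,
    F f (natvec R k) = tau ->
    nu (natvec R k) >=
      sigma R f * (N f (natvec R k) + 1) - sigma R (restr f tau).
Proof.
move=> kn Ftau; set k := natvec R kn; set g := restr f tau.
have k0 : orthant k := orthant_natvec R n kn.
have fn0 : f != 0 by apply/eqP => e; apply: (f_nonconstant 0); rewrite e mpolyC0.
(* In zero variables every polynomial is constant. *)
have n_gt0 : (0 < n)%N.
  rewrite lt0n; apply/eqP => n0; move: f f_nonconstant {f0 tau_face Ftau g fn0}.
  rewrite n0 => f h; apply: (h f@_0%MM); apply/mpolyP => m.
  by rewrite mcoeffC nvar0_mnmE eqxx mulr1.
have [[m0 fm0 NE] Nmin] := N_attained R n f k fn0 k0.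
have f00 : f@_0%MM = 0 by rewrite -mcoeff0_eval.
have gap (m : 'X_{1..n}) : f@_m != 0 -> ~ tau (natvec R m) -> N f k + 1 <= dot k (natvec R m).
  move=> fm mt; have Dm := Delta0_natvec R n f m fm.
  have : N f k < dot k (natvec R m).
    rewrite lt_neqAle Nmin // andbT; apply/eqP => e; apply: mt.
    by rewrite -Ftau; split.
  by rewrite NE !dot_natvec ltr_nat natr1 ler_nat.
have nu_k : 0 <= nu k by apply: sumr_ge0 => j _.
have st0 : 0 <= sigma R g := sigma_ge0 R n g n_gt0.
(* If [sigma R f] is the default 0, the claim follows from [nu_k] and [st0]. *)
rewrite {1}/sigma; case: xgetP => [s _ sf|_]; last by rewrite mul0r sub0r; lra.
have [s_gt0 /Delta0P [r [m [w [hm w0 w1 hx]]]]] := is_sigma_gt0 R n f s n_gt0 sf.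
pose T l := `[< tau (natvec R (m l)) >].
pose W := \sum_(l | T l) w l.
have W0 : 0 <= W by apply: sumr_ge0.
(* Points of [tau] pair with [k] to [N f k], all others to at least [N f k + 1]. *)
have key : N f k + 1 - W <= s^-1 * nu k.
  have := dot_ge0 R n k _ k0 hx; rewrite dotBr dot_const subr_ge0.
  apply: le_trans; rewrite dot_sumr.
  have -> : N f k + 1 - W = \sum_l (w l * (N f k + 1) - (if T l then w l else 0)).
    by rewrite sumrB -mulr_suml w1 mul1r -big_mkcond.
  apply: ler_sum => l _; rewrite dotZr; case: ifP => Tl.
    rewrite -[X in _ - X]mulr1 -mulrBr addrK ler_wpM2l // Nmin //.
    exact: Delta0_natvec.
  by rewrite subr0 ler_wpM2l // gap // => t; move/asboolP: Tl; apply.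
have {}key : s * (N f k + 1) - s * W <= nu k.
  by have := ler_wpM2l (ltW s_gt0) key; rewrite mulrA mulfV ?gt_eqF // mul1r mulrBr.
suff : s * W <= sigma R g by lra.
(* When no weight lies on [tau], [s * W] is 0 and [st0] suffices; otherwise one may divide by
   [W]. *)
have [W_gt0|W_le0] := ltP 0 W; last by nra.
have [l0 Tl0] : exists l, T l.
  apply/existsP; apply: contraPT W_gt0; rewrite negb_exists => /forallP h.
  by rewrite /W big_pred0 ?ltxx // => l; apply/negbTE.
have gE := mcoeff_restr R n f tau.
have gm l : T l -> g@_(m l) != 0 by move=> Tl; rewrite gE -/(T l) Tl.
have gn0 : g != 0.
  by apply/eqP => e; have := gm l0 Tl0; rewrite e mcoeff0 eqxx.
have g0 : g@_0%MM = 0 by rewrite gE f00 if_same.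
have sg : is_sigma g (sigma R g) := xgetPex 0 (is_sigma_exists R n g gn0 g0).
have [sg_gt0 _] := is_sigma_gt0 R n g _ n_gt0 sg.
suff D : Delta0 R g (const_mx (s * W)^-1).
  have := is_sigma_min R n g _ _ gn0 sg D n_gt0.
  by rewrite lef_pV2 // posrE ?mulr_gt0.
(* Indices off [tau] get weight 0 and the placeholder exponent [m l0], so that every listed exponent
   is in the support of [g]. *)
apply/Delta0P; exists r, (fun l => m (if T l then l else l0)),
  (fun l => if T l then w l / W else 0); split=> [l|l||j].
- by apply: gm; case: ifP.
- by case: ifP => // _; rewrite divr_ge0.
- by rewrite -big_mkcond -mulr_suml divff ?gt_eqF.
(* After multiplication by [W], the sum is that of [hx] with its nonnegative terms off [tau]
   dropped. *)
rewrite !mxE subr_ge0 summxE invfM ler_pdivlMr // mulr_suml.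
have := hx j; rewrite !mxE subr_ge0 summxE; apply: le_trans.
apply: ler_sum => l _; rewrite !mxE; case: ifP => _.
  by rewrite mulrAC divfK ?gt_eqF.
by rewrite !mul0r mulr_ge0.
Qed.
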